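(* Let $R,C,N,Q\ge1$ be integers and let $1=r_1<r_2<\cdots<r_{N+1}\le R+1$ and $1=c_1<c_2<\cdots<c_{N+1}\le C+1$ be integers. Let $S_n=\{(i,j)\mid r_n\le i<r_{n+1},\ c_n\le j<c_{n+1}\}$ for $n=1,\ldots,N$. Let $\hat{\mathcal{N}}_1,\ldots,\hat{\mathcal{N}}_Q$ be subsets of $\{1,\ldots,N\}$ with $\hat{\mathcal{N}}_q\cap\hat{\mathcal{N}}_{q'}=\emptyset$ for $1\le q<q'\le Q$, and let $T_q=\bigcup_{n\in\hat{\mathcal{N}}_q}S_n$ for $q=1,\ldots,Q$. Then the set of moves of Types I, II, III and IV in $\mathcal{M}_{T_1,\ldots,T_Q}$ forms a Markov basis for the configuration $A_{T_1,\ldots,T_Q}$.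
   Context: Let $\mathbb{N}=\{0,1,2,\ldots\}$ and $\mathcal{I}=\{(i,j)\mid 1\le i\le R,\ 1\le j\le C\}$. The configuration $A=A_{T_1,\ldots,T_Q}$ is the zero-one matrix with $A\mathbf{x}=(x_{1+},\ldots,x_{R+},x_{+1},\ldots,x_{+C},x_{T_1},\ldots,x_{T_Q})'$ for $\mathbf{x}=(x_{ij})_{(i,j)\in\mathcal{I}}$, where $x_{i+}=\sum_jx_{ij}$, $x_{+j}=\sum_ix_{ij}$, $x_{T_q}=\sum_{(i,j)\in T_q}x_{ij}$. The set of moves is $\mathcal{M}_{T_1,\ldots,T_Q}=\{\mathbf{z}\in\mathbb{Z}^{\mathcal{I}}\mid A\mathbf{z}=0\}$, and the fibers are $\mathcal{F}_{\mathbf{t}}=\{\mathbf{x}\in\mathbb{N}^{\mathcal{I}}\mid A\mathbf{x}=\mathbf{t}\}$. A finite set $\mathcal{B}$ of moves that is sign-invariant ($\mathbf{z}\in\mathcal{B}\Rightarrow-\mathbf{z}\in\mathcal{B}$) is a Markov basis for $A$ if for every $\mathbf{t}$ and all $\mathbf{x}\ne\mathbf{y}$ in $\mathcal{F}_{\mathbf{t}}$ there exist $U>0$ and $\mathbf{z}_1,\ldots,\mathbf{z}_U\in\mathcal{B}$ (repetitions allowed) with $\mathbf{y}=\mathbf{x}+\sum_{s=1}^{U}\mathbf{z}_s$ and $\mathbf{x}+\sum_{s=1}^{u}\mathbf{z}_s\in\mathcal{F}_{\mathbf{t}}$ for $1\le u\le U$. Blocks: the rows are partitioned into the blocks of rows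 $\{i\mid r_k\le i<r_{k+1}\}$, $1\le k\le N$, together with $\{i\mid r_{N+1}\le i\le R\}$ if nonempty; the columns are partitioned likewise using $c_1,\ldots,c_{N+1}$ and $C$. A block is the product of a block of rows and a block of columns; in particular each $S_n$ is a block. Put $S=T_1\cup\cdots\cup T_Q$ and $S^C=\mathcal{I}\setminus S$; both are unions of blocks. Let $E_{ij}$ denote the table with entry $1$ at $(i,j)$ and $0$ elsewhere. Type I: $E_{i_1j_1}+E_{i_2j_2}-E_{i_1j_2}-E_{i_2j_1}$ with $i_1\ne i_2$, $j_1\ne j_2$. Type II: $E_{i_1j_2}+E_{i_2j_3}+E_{i_3j_1}-E_{i_1j_3}-E_{i_2j_1}-E_{i_3j_2}$ with $i_1,i_2,i_3$ distinct and $j_1,j_2,j_3$ distinct, where the six nonzero cells belong to distinct blocks in $S^C$. Type III: $E_{i_1j_1}+E_{i_2j_3}+E_{i_3j_2}-E_{i_1j_3}-E_{i_2j_2}-E_{i_3j_1}$ with $i_1,i_2,i_3$ distinct and $j_1,j_2,j_3$ distinct, where $(i_1,j_1)$ and $(i_2,j_2)$ belong to distinct blocks in $S$ and the other four nonzero cells belong to distinct blocks in $S^C$. Type IV: $E_{i_1j_1}+E_{i_2j_2}+E_{i_3j_3}+E_{i_4j_4}-E_{i_1j_3}-E_{i_2j_4}-E_{i_3j_2}-E_{i_4j_1}$, where $(i_1,j_1)$ and $(i_3,j_2)$ belong to distinct blocks in $S$, the other six listed cells belong to (not necessarily distinct) blocks in $S^C$, rows $i_1,i_2$ belong to the same block of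 rows, and rows $i_3,i_4$ belong to the same block of rows; the indices need not be distinct ($i_1=i_2$, $i_3=i_4$, $j_3=j_4$ are allowed), so these moves of degree 4 may be square-free or not. Type IV also includes the transposes of these moves: $E_{i_1j_1}+E_{i_2j_2}+E_{i_3j_3}+E_{i_4j_4}-E_{i_3j_1}-E_{i_4j_2}-E_{i_2j_3}-E_{i_1j_4}$, where $(i_1,j_1)$ and $(i_2,j_3)$ belong to distinct blocks in $S$, the other six listed cells belong to blocks in $S^C$, columns $j_1,j_2$ belong to the same block of columns, and columns $j_3,j_4$ belong to the same block of columns (indices not necessarily distinct). *)

(* Defs.v *)
From mathcomp Require Import mathcomp_extra boolp classical_sets functions.
From mathcomp Require Import cardinality.
From mathcomp Require Import all_boot all_order all_algebra.

Set Implicit Arguments.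
Unset Strict Implicit.
Unset Printing Implicit Defensive.

Import Order.TTheory GRing.Theory Num.Theory.
Local Open Scope ring_scope.

(* Rows, columns, blocks and the indices q are numbered from 0.  Cut points   *)
(* are functions [r : nat -> nat] of which only r 0, ..., r N are used: r k   *)
(* is the 0-based position of the first line of block k, so that the 1-based  *)
(* cut points are r_{k+1} = r k + 1.                                          *)

Notation cell R C := ('I_R * 'I_C)%type.
Notation table R C := ('M[int]_(R, C)).

Section MarkovBasis.
Context {R C d : nat}.
Implicit Types (A : 'M[int]_(d, R * C)) (x y z : table R C) (t : 'cV[int]_d).

(* The columns of a configuration are indexed by the cells through [mxvec],   *)
(* so [statistic A x] is the product A x of the matrix A and the table x.     *)
Definition statistic A x : 'cV[int]_d := A *m (mxvec x)^T.

Definition moves A : set (table R C) := [set z : table R C | statistic A z = 0]%classic.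

Definition fiber A t : set (table R C) :=
  [set x : table R C | (forall i j, 0 <= x i j) /\ statistic A x = t]%classic.

Definition connects A (B : set (table R C)) :=
  forall t x y, fiber A t x -> fiber A t y -> x <> y ->
  exists zs : seq (table R C),
    [/\ (0 < size zs)%N,
        forall z, z \in zs -> B z,
        y = x + \sum_(z <- zs) z
      & forall u, (1 <= u <= size zs)%N ->
          fiber A t (x + \sum_(z <- take u zs) z)].

Definition is_markov_basis A (B : set (table R C)) :=
  [/\ finite_set B,
      (B `<=` moves A)%classic,
      forall z, B z -> B (- z)
    & connects A B].

End MarkovBasis.

Definition indicator_table {R C : nat} (D : {set cell R C}) : table R C :=
  \matrix_(i, j) ((i, j) \in D)%:R.

(* The three bands of rows compute the row sums, the column sums and the sums *)
(* over the T q: see [statistic_configuration] below.                         *)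
Definition configuration {R C Q : nat} (T : 'I_Q -> {set cell R C}) :
    'M[int]_(R + C + Q, R * C) :=
  col_mx
    (col_mx (\matrix_(i < R) mxvec (indicator_table [set c | c.1 == i]))
            (\matrix_(j < C) mxvec (indicator_table [set c | c.2 == j])))
    (\matrix_(q < Q) mxvec (indicator_table (T q))).

Lemma indicator_tableP {R C : nat} (D : {set cell R C}) (x : table R C) i j :
  (mxvec (indicator_table D) *m (mxvec x)^T) i j = \sum_(e in D) x e.1 e.2.
Proof.
rewrite mxE (reindex _ (curry_mxvec_bij R C)) /= [RHS]big_mkcond /=.
apply: eq_bigr => -[a b] _; rewrite /= [in X in _ * X]mxE !ord1 !mxvecE mxE.
by case: ifP; rewrite ?mul1r ?mul0r.
Qed.

Lemma statistic_configuration {R C Q : nat} (T : 'I_Q -> {set cell R C})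
    (x : table R C) :
  statistic (configuration T) x =
  col_mx (col_mx (\col_i \sum_j x i j) (\col_j \sum_i x i j))
         (\col_q \sum_(e in T q) x e.1 e.2).
Proof.
have rows n (F : 'I_n -> {set cell R C}) :
    (\matrix_(k < n) mxvec (indicator_table (F k))) *m (mxvec x)^T =
    \col_k \sum_(e in F k) x e.1 e.2.
  apply/colP=> k; rewrite [RHS]mxE -(indicator_tableP _ _ 0 0) !mxE.
  by apply: eq_bigr => l _; rewrite mxE.
rewrite /statistic /configuration !mul_col_mx !rows.
congr (col_mx (col_mx _ _) _); apply/colP=> k; rewrite !mxE.
  rewrite (eq_bigl (fun e : cell R C => (e.1 == k) && true)); last first.
    by move=> e; rewrite inE andbT.
  by rewrite -(pair_big (fun i => i == k) xpredT (fun i j => x i j)) big_pred1_eq.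
rewrite (eq_bigl (fun e : cell R C => true && (e.2 == k))); last first.
  by move=> e; rewrite inE.
rewrite -(pair_big xpredT (fun j => j == k) (fun i j => x i j)) /=.
by apply: eq_bigr => i _; rewrite big_pred1_eq.
Qed.

Section Blocks.
Context {R C : nat} (N : nat) (r c : nat -> nat).

(* The blocks of lines cut out of 'I_n by r.  The lines from r N on form one  *)
(* more block, unless there are none.                                         *)
Definition line_blocks (n : nat) (s : nat -> nat) : {set {set 'I_n}} :=
  [set [set i : 'I_n | (s k <= i < s k.+1)%N] | k : 'I_N] :|:
  ([set [set i : 'I_n | (s N <= i)%N]] :\ set0).

Definition blocks : {set {set cell R C}} :=
  [set setX P P' | P in line_blocks R r, P' in line_blocks C c].

Definition same_row_block (i i' : 'I_R) :=
  pblock (line_blocks R r) i == pblock (line_blocks R r) i'.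

Definition same_col_block (j j' : 'I_C) :=
  pblock (line_blocks C c) j == pblock (line_blocks C c) j'.

Definition cells_in (D : {set cell R C}) (cs : seq (cell R C)) :=
  all (fun e => e \in D) cs.

(* To be used when D is a union of blocks: the block containing a cell of D   *)
(* is then included in D.                                                     *)
Definition in_distinct_blocks (D : {set cell R C}) (cs : seq (cell R C)) :=
  cells_in D cs && uniq [seq pblock blocks e | e <- cs].

Definition diag_block (n : 'I_N) : {set cell R C} :=
  [set e : cell R C | (r n <= e.1 < r n.+1)%N && (c n <= e.2 < c n.+1)%N].

Definition subtable {Q : nat} (Nhat : 'I_Q -> {set 'I_N}) (q : 'I_Q) :
    {set cell R C} :=
  (\bigcup_(n in Nhat q) diag_block n)%SET.

Local Notation E i j := (delta_mx i j : table R C).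

Definition type1 (z : table R C) :=
  exists i1 i2 j1 j2,
    [/\ i1 != i2, j1 != j2 & z = E i1 j1 + E i2 j2 - E i1 j2 - E i2 j1].

Variable S : {set cell R C}.

Definition type2 (z : table R C) :=
  exists i1 i2 i3 j1 j2 j3,
    [/\ uniq [:: i1; i2; i3], uniq [:: j1; j2; j3],
        in_distinct_blocks (~: S)
          [:: (i1, j2); (i2, j3); (i3, j1); (i1, j3); (i2, j1); (i3, j2)]
      & z = E i1 j2 + E i2 j3 + E i3 j1 - E i1 j3 - E i2 j1 - E i3 j2].

Definition type3 (z : table R C) :=
  exists i1 i2 i3 j1 j2 j3,
    [/\ uniq [:: i1; i2; i3], uniq [:: j1; j2; j3],
        in_distinct_blocks S [:: (i1, j1); (i2, j2)],
        in_distinct_blocks (~: S) [:: (i2, j3); (i3, j2); (i1, j3); (i3, j1)]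
      & z = E i1 j1 + E i2 j3 + E i3 j2 - E i1 j3 - E i2 j2 - E i3 j1].

(* The indices are not required to be distinct.                               *)
Definition type4_rows (z : table R C) :=
  exists i1 i2 i3 i4 j1 j2 j3 j4,
    [/\ in_distinct_blocks S [:: (i1, j1); (i3, j2)],
        cells_in (~: S)
          [:: (i2, j2); (i3, j3); (i4, j4); (i1, j3); (i2, j4); (i4, j1)],
        same_row_block i1 i2, same_row_block i3 i4
      & z = E i1 j1 + E i2 j2 + E i3 j3 + E i4 j4
            - E i1 j3 - E i2 j4 - E i3 j2 - E i4 j1].

(* The transposes of the tables of [type4_rows].                              *)
Definition type4_cols (z : table R C) :=
  exists i1 i2 i3 i4 j1 j2 j3 j4,
    [/\ in_distinct_blocks S [:: (i1, j1); (i2, j3)],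
        cells_in (~: S)
          [:: (i2, j2); (i3, j3); (i4, j4); (i3, j1); (i4, j2); (i1, j4)],
        same_col_block j1 j2, same_col_block j3 j4
      & z = E i1 j1 + E i2 j2 + E i3 j3 + E i4 j4
            - E i3 j1 - E i4 j2 - E i2 j3 - E i1 j4].

Definition type4 (z : table R C) := type4_rows z \/ type4_cols z.

Definition typed_tables : set (table R C) :=
  [set z : table R C | [\/ type1 z, type2 z, type3 z | type4 z]]%classic.

End Blocks.

(* Main.v *)
(* Take x, y in one fiber and walk from both of them, by typed moves inside   *)
(* the fiber, until their L1-distance is minimal; the claim is that then      *)
(* x = y.  Let z = y - x.                                                     *)
(* - If z has opposite signs in one row and one column block (or dually), a   *)
(*   Type I move shortens the distance.  If it has opposite signs in one      *)
(*   block, a Type I move that keeps the distance leads to the former case.   *)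
(*   So z has a constant sign on each block.                                  *)
(* - If z is nonzero on S, its zero sum on some T_q gives blocks S_n, S_m in  *)
(*   T_q with z > 0 somewhere on S_n and z < 0 somewhere on S_m.  A Type III  *)
(*   move on x is shortening unless z takes negative values in the rows of    *)
(*   S_n and columns of S_m, or in the rows of S_m and columns of S_n; one on *)
(*   y is, unless z takes positive values in one of these two blocks.  As     *)
(*   signs are constant, one of these blocks is positive and the other is     *)
(*   negative, and a Type IV move is shortening.                              *)
(* - If z vanishes on S, the fourth corner of any rectangle with signs        *)
(*   -, +, - at three corners lies in S, for otherwise a Type I move is       *)
(*   shortening.  Following such rectangles gives the hexagon of a            *)
(*   shortening Type II move.                                                 *)

Require Import Defs.
From mathcomp Require Import mathcomp_extra boolp classical_sets functions.
From mathcomp Require Import cardinality.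
From mathcomp Require Import all_boot all_order all_algebra.
From mathcomp Require Import zify.

Set Implicit Arguments.
Unset Strict Implicit.
Unset Printing Implicit Defensive.

Import Order.TTheory GRing.Theory Num.Theory.
Local Open Scope ring_scope.

(** Moves are treated as exchanges of tokens between cells. If tokens leave only cells where [x]
    exceeds [y], the table stays nonnegative, and the L1 distance falls once the removed tokens,
    together with those added where [x] falls short of [y], outnumber the other added ones
    ([dist_exchange]). The typed moves are closed under negation, so walks can be reversed and may
    start from both tables; by [stuck_connects] it remains to see that a pair at minimal distance
    consists of equal tables. The row, column and [T q] sums of such a pair agree, so every shortage
    comes with an excess in the same line or subtable; these supply the cells of a shortening
    exchange. Two facts make it a typed move: opposite signs never occur in one block
    ([same_block_signs]), and [S] has at most one block in each block of lines ([S_match]). Types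
    III and IV settle the cells of [S] ([le_on_S]), Type II the others ([stuck_le]); equality
    follows by swapping the two tables. *)

(** * Sign changes between functions with equal sums *)

Lemma sumr_sign_change (I : finType) (P : pred I) (f g : I -> int) (i : I) :
  \sum_(k | P k) f k = \sum_(k | P k) g k -> P i -> f i < g i ->
  exists2 k, P k & g k < f k.
Proof.
move=> eq_fg Pi lt_i; apply/exists_inP; apply: contraT => /exists_inPn le_fg.
suff: \sum_(k | P k) f k < \sum_(k | P k) g k by rewrite eq_fg ltxx.
rewrite (bigD1 i) // [ltRHS](bigD1 i) //= ltr_leD // ler_sum //.
by move=> k /andP[Pk _]; rewrite leNgt le_fg.
Qed.

(** Feeds the Type IV moves, which may take two tokens from one cell: hence the excess of 2 when
    [k = k']. If the first excess found is only 1, the deficits at [i] and [i'] call for another one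
    elsewhere. *)
Lemma sumr_two_sign_changes (I : finType) (f g : I -> int) (i i' : I) :
  \sum_k f k = \sum_k g k -> i != i' -> f i < g i -> f i' < g i' ->
  exists k k', [/\ g k < f k, g k' < f k' & k = k' -> g k + 2 <= f k].
Proof.
move=> eq_fg ni lt_i lt_i'.
have [k _ lt_k] := sumr_sign_change eq_fg isT lt_i.
have [le2|gt2] := leP (g k + 2) (f k); first by exists k, k.
have nik : i != k by apply: contraTneq lt_k => <-; rewrite -leNgt ltW.
have nik' : i' != k by apply: contraTneq lt_k => <-; rewrite -leNgt ltW.
have eq1 : \sum_(l | l != k) f l + 1 = \sum_(l | l != k) g l.
  have fk : f k = g k + 1.
    by apply/eqP; rewrite eq_le lezD1 lt_k -ltzD1 -addrA gt2.
  move: eq_fg; rewrite (bigD1 k) // [RHS](bigD1 k) //= fk -addrA.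
  by move=> /addrI <-; rewrite addrC.
have [/exists_inP[l nlk lt_l]|/exists_inPn le_fg] :=
    boolP [exists (l | l != k), g l < f l].
  by exists k, l; split=> // ekl; rewrite ekl eqxx in nlk.
(* With no other excess, [i] and [i'] each contribute at least 1 to a deficit that [eq1] says is
   exactly 1. *)
have : \sum_(l | l != k) f l + 2 <= \sum_(l | l != k) g l.
  rewrite (bigD1 i) // (bigD1 i') /=; last by rewrite nik' eq_sym.
  rewrite [leRHS](bigD1 i) // [in leRHS](bigD1 i') /=; last first.
    by rewrite nik' eq_sym.
  have : \sum_(l | (l != k) && (l != i) && (l != i')) f l <=
         \sum_(l | (l != k) && (l != i) && (l != i')) g l.
    by apply: ler_sum => l /andP[/andP[nl _] _]; rewrite leNgt le_fg.
  move: (\sum_(l | _) f l) (\sum_(l | _) g l); lia.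
by rewrite -eq1 lerD2l.
Qed.

(** * Exchanging tokens between cells *)

Section Exchange.
Context {R C : nat}.
Implicit Types (s ad rm ga ba : seq (cell R C)) (x y z : table R C).

(** The list is read as a multiset, so that a cell may carry several tokens. *)
Definition token_table s : table R C := \sum_(e <- s) delta_mx e.1 e.2.

Definition exchange ad rm := token_table ad - token_table rm.

Lemma token_tableE s i j : token_table s i j = (count_mem (i, j) s)%:Z.
Proof.
elim: s => [|[a b] s IH]; rewrite /token_table ?big_nil ?mxE // big_cons mxE.
rewrite -/(token_table s) IH mxE /= -xpair_eqE eq_sym PoszD.
by case: eqP.
Qed.

Lemma sum_token_table s (D : {set cell R C}) :
  \sum_(e in D) token_table s e.1 e.2 = (count [in D] s)%:Z.
Proof.
elim: s => [|e s IH]; rewrite /token_table.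
  by rewrite big1 // => e _; rewrite big_nil mxE.
under eq_bigr do rewrite big_cons mxE.
rewrite big_split -/(token_table s) IH /= PoszD; congr (_ + _).
rewrite (eq_bigr (fun e' => (e' == e)%:R)); last first.
  by case: e => a b [a' b'] _; rewrite mxE xpair_eqE.
have [De|nDe] := boolP (e \in D).
  rewrite (bigD1 e) //= eqxx big1 ?addr0 // => e' /andP[_ /negPf -> //].
by rewrite big1 // => e' De'; case: eqP nDe => // <-; rewrite De'.
Qed.

Lemma row_sumE x i : \sum_j x i j = \sum_(e in [set e | e.1 == i]) x e.1 e.2.
Proof.
rewrite (eq_bigl (fun e : cell R C => (e.1 == i) && true)); last first.
  by move=> e; rewrite inE andbT.
by rewrite -(pair_big (fun k => k == i) xpredT (fun i j => x i j)) big_pred1_eq.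
Qed.

Lemma col_sumE x j : \sum_i x i j = \sum_(e in [set e | e.2 == j]) x e.1 e.2.
Proof.
rewrite (eq_bigl (fun e : cell R C => true && (e.2 == j))); last first.
  by move=> e; rewrite inE.
rewrite -(pair_big xpredT (fun k => k == j) (fun i j => x i j)) /=.
by apply: eq_bigr => i _; rewrite big_pred1_eq.
Qed.

Definition dist x y : nat := \sum_(e : cell R C) `|x e.1 e.2 - y e.1 e.2|%N.

Lemma distC x y : dist x y = dist y x.
Proof. by apply: eq_bigr => e _; rewrite distnC. Qed.

Lemma sum_count_mem s : (\sum_(e : cell R C) count_mem e s)%N = size s.
Proof.
elim: s => [|e s IH]; first by rewrite big1.
rewrite /= big_split /= IH -add1n; congr (_ + _)%N.
by rewrite (bigD1 e) //= eqxx big1 // => e' /negPf; rewrite eq_sym => ->.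
Qed.

(* The tokens rm are removed where x exceeds y, the tokens ga are added where *)
(* x falls short of y; nothing is known about the other added tokens, ba.     *)
Lemma dist_exchange x y rm ga ba :
  (forall e, e \in rm -> y e.1 e.2 + (count_mem e rm)%:Z <= x e.1 e.2) ->
  (forall e, e \in ga -> x e.1 e.2 + (count_mem e ga)%:Z <= y e.1 e.2) ->
  (dist (x + exchange (ga ++ ba) rm) y + size rm + size ga
     <= dist x y + size ba)%N.
Proof.
move=> rmP gaP; rewrite -!sum_count_mem /dist -!big_split.
apply: leq_sum => e _.
rewrite /= !mxE !token_tableE -surjective_pairing count_cat.
(* The estimate at one cell, for [m] removed, [n] good and [p] other added tokens; [m] and [n]
   cannot both be positive. *)
have bound (a b : int) (m n p : nat) :
    ((0 < m)%N -> b + m%:Z <= a) -> ((0 < n)%N -> a + n%:Z <= b) ->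
    (`|(a + ((n + p)%N%:Z - m%:Z) - b)%R| + m + n <= `|(a - b)%R| + p)%N by lia.
by apply: bound; rewrite -has_count has_pred1; [apply: rmP | apply: gaP].
Qed.

(** Removals never take an entry of [x] below that of [y], which is nonnegative. *)
Lemma exchange_ge0 x y ad rm :
  (forall i j, 0 <= x i j) -> (forall i j, 0 <= y i j) ->
  (forall e, e \in rm -> y e.1 e.2 + (count_mem e rm)%:Z <= x e.1 e.2) ->
  forall i j, 0 <= (x + exchange ad rm) i j.
Proof.
move=> x0 y0 rmP i j; rewrite !mxE !token_tableE.
have bound (a b : int) (m n : nat) : 0 <= a -> 0 <= b ->
    ((0 < m)%N -> b + m%:Z <= a) -> 0 <= a + (n%:Z - m%:Z) by lia.
by apply: (bound _ _ _ _ (x0 i j) (y0 i j)); rewrite -has_count has_pred1 => /rmP.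
Qed.

Lemma lt_uniq_count x y s :
  uniq s -> all (fun e => y e.1 e.2 < x e.1 e.2) s ->
  forall e, e \in s -> y e.1 e.2 + (count_mem e s)%:Z <= x e.1 e.2.
Proof.
by move=> us /allP lt_s e es; rewrite count_uniq_mem // es lezD1; apply: lt_s.
Qed.

(* For the non-square-free moves of Type IV, where a = b.                     *)
Lemma lt_pair_count x y (a b : cell R C) s :
  uniq s -> a \notin s -> b \notin s ->
  all (fun e => y e.1 e.2 < x e.1 e.2) [:: a, b & s] ->
  (a = b -> y a.1 a.2 + 2 <= x a.1 a.2) ->
  forall e, e \in [:: a, b & s] ->
    y e.1 e.2 + (count_mem e [:: a, b & s])%:Z <= x e.1 e.2.
Proof.
move=> us na nb lt_s dbl; have [eab|nab] := eqVneq a b; last first.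
  by apply: lt_uniq_count; rewrite //= inE negb_or nab na nb.
rewrite -eab => e; rewrite !inE orbA orbb => /predU1P[->|es] /=.
  by rewrite eqxx (count_memPn na); apply: dbl.
have nae : (a == e) = false by apply: contraNF na => /eqP->.
by rewrite nae !add0n; apply: lt_uniq_count => //; case/and3P: lt_s.
Qed.

End Exchange.

(** * Exchanges that preserve the statistic *)

Section Statistic.
Context {R C d : nat} (A : 'M[int]_(d, R * C)).
Implicit Types (x y : table R C).

Lemma statisticD x y : statistic A (x + y) = statistic A x + statistic A y.
Proof. by rewrite /statistic linearD /= linearD mulmxDr. Qed.

Lemma statisticN x : statistic A (- x) = - statistic A x.
Proof. by rewrite /statistic linearN /= linearN mulmxN. Qed.

End Statistic.

Section Configuration.
Context {R C Q : nat} (T : 'I_Q -> {set cell R C}).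
Implicit Types (s ad rm : seq (cell R C)) (x y z : table R C).
Local Notation A := (configuration T).

Lemma eq_statistic x y :
  statistic A x = statistic A y <->
  [/\ forall i, \sum_j x i j = \sum_j y i j,
      forall j, \sum_i x i j = \sum_i y i j
    & forall q, \sum_(e in T q) x e.1 e.2 = \sum_(e in T q) y e.1 e.2].
Proof.
rewrite !statistic_configuration; split=> [|[eqr eqc eqT]].
  move=> /eq_col_mx[/eq_col_mx[/colP eqr /colP eqc] /colP eqT].
  by split=> k; [have := eqr k | have := eqc k | have := eqT k]; rewrite !mxE.
by congr (col_mx (col_mx _ _) _); apply/colP=> k; rewrite !mxE.
Qed.

Lemma statistic_token_table s s' :
  perm_eq [seq e.1 | e <- s] [seq e.1 | e <- s'] ->
  perm_eq [seq e.2 | e <- s] [seq e.2 | e <- s'] ->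
  (forall q, count [in T q] s = count [in T q] s') ->
  statistic A (token_table s) = statistic A (token_table s').
Proof.
move=> /permP eqr /permP eqc eqT; apply/eq_statistic; split=> [i|j|q].
- have rowE u : count [in [set e : cell R C | e.1 == i]] u =
      count_mem i [seq e.1 | e <- u].
    by rewrite count_map; apply: eq_count => e; rewrite /= inE.
  by rewrite !row_sumE !sum_token_table !rowE eqr.
- have colE u : count [in [set e : cell R C | e.2 == j]] u =
      count_mem j [seq e.2 | e <- u].
    by rewrite count_map; apply: eq_count => e; rewrite /= inE.
  by rewrite !col_sumE !sum_token_table !colE eqc.
- by rewrite !sum_token_table eqT.
Qed.

Lemma exchange_moves ad rm :
  perm_eq [seq e.1 | e <- ad] [seq e.1 | e <- rm] ->
  perm_eq [seq e.2 | e <- ad] [seq e.2 | e <- rm] ->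
  (forall q, count [in T q] ad = count [in T q] rm) ->
  moves A (exchange ad rm).
Proof.
move=> *; rewrite /moves /= statisticD statisticN.
by rewrite (statistic_token_table (s' := rm)) // subrr.
Qed.

End Configuration.

(** * Walks in a fiber *)

Section Walk.
Context {R C d : nat} (A : 'M[int]_(d, R * C)) (B : set (table R C)).
Hypothesis B_moves : forall z, B z -> statistic A z = 0.
Hypothesis BN : forall z, B z -> B (- z).
Implicit Types (x y z : table R C) (t : 'cV[int]_d).

(** As in [connects], only the tables reached after a step are required to lie in the fiber. *)
Inductive walk t : table R C -> table R C -> Prop :=
| walk_refl x : walk t x x
| walk_step x z y : B z -> fiber A t (x + z) -> walk t (x + z) y -> walk t x y.

Lemma walk_trans t x y z : walk t x y -> walk t y z -> walk t x z.
Proof. by elim=> // a u b Bu fu _ IH /IH; exact: walk_step. Qed.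

Lemma walk_fiber t x y : walk t x y -> fiber A t x -> fiber A t y.
Proof. by elim=> // a u b _ fu _ IH _; apply: IH. Qed.

Lemma walk_sym t x y : fiber A t x -> walk t x y -> walk t y x.
Proof.
move=> fx w; elim: w fx => [a _|a u b Bu fu _ IH fa]; first exact: walk_refl.
apply: walk_trans (IH fu) _; apply: (@walk_step _ _ (- u)); rewrite ?addrK //.
  exact: BN.
exact: walk_refl.
Qed.

Lemma walk_seq t x y :
  walk t x y -> exists zs,
    [/\ forall z, z \in zs -> B z, y = x + \sum_(z <- zs) z
      & forall u, (1 <= u <= size zs)%N ->
          fiber A t (x + \sum_(z <- take u zs) z)].
Proof.
elim=> [a|a u b Bu fu _ [zs [Bzs -> fzs]]].
  by exists [::]; split=> // [|[|u]] //; rewrite big_nil addr0.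
exists (u :: zs); split=> [z|| [|k] //= lek].
- by rewrite inE => /predU1P[->|/Bzs].
- by rewrite big_cons addrA.
rewrite big_cons addrA; case: k lek => [_|k lek].
  by rewrite take0 big_nil addr0.
by apply: fzs.
Qed.

Lemma descent_connects :
  (forall t x y, fiber A t x -> fiber A t y -> x <> y ->
     exists x' y', [/\ walk t x x', walk t y y' & (dist x' y' < dist x y)%N]) ->
  connects A B.
Proof.
move=> descent t x y fx fy neq_xy.
suff [zs [Bzs yE fzs]] : exists zs, [/\ forall z, z \in zs -> B z,
    y = x + \sum_(z <- zs) z & forall u, (1 <= u <= size zs)%N ->
          fiber A t (x + \sum_(z <- take u zs) z)].
  exists zs; split=> //; case: zs yE {Bzs fzs} => // yE.
  by case: neq_xy; rewrite yE big_nil addr0.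
(* Induction on a strict bound for the distance. *)
apply: walk_seq; move: {2}_.+1 (ltnSn (dist x y)) => n.
elim: n x y fx fy {neq_xy} => // n IH x y fx fy le_n.
have [-> | /eqP neq_xy] := eqVneq x y; first exact: walk_refl.
have [x' [y' [wx wy lt_d]]] := descent _ _ _ fx fy neq_xy.
have [fx' fy'] := (walk_fiber wx fx, walk_fiber wy fy).
apply: walk_trans wx (walk_trans _ (walk_sym fy wy)).
by apply: IH => //; apply: leq_trans lt_d _.
Qed.

(** Minimality ranges over all reachable pairs, not just over one step, so that it survives
    exchanges that keep the distance ([exchange_stuck]). *)
Definition stuck t x y := [/\ fiber A t x, fiber A t y &
  forall x' y', walk t x x' -> walk t y y' -> (dist x y <= dist x' y')%N].

Lemma stuck_sym t x y : stuck t x y -> stuck t y x.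
Proof.
move=> [fx fy min_xy]; split=> // x' y' wx wy.
by rewrite distC [leqRHS]distC; apply: min_xy.
Qed.

Lemma stuck_connects :
  (forall t x y, stuck t x y -> x = y) -> connects A B.
Proof.
move=> stuck_eq; apply: descent_connects => t x y fx fy neq_xy.
apply: contrapT => no_descent; case: neq_xy; apply: (stuck_eq t); split=> //.
move=> x' y' wx wy; rewrite leqNgt; apply/negP=> lt_d.
by apply: no_descent; exists x', y'.
Qed.

Lemma walk_exchange t x y ad rm : fiber A t x -> fiber A t y ->
  (forall e, e \in rm -> y e.1 e.2 + (count_mem e rm)%:Z <= x e.1 e.2) ->
  B (exchange ad rm) -> walk t x (x + exchange ad rm).
Proof.
move=> [x0 xt] [y0 _] rmP Be; apply: walk_step (Be) _ (walk_refl _ _).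
split; first exact: exchange_ge0 rmP.
by rewrite statisticD (B_moves Be) addr0.
Qed.

(** Used to refute: with fewer tokens in [ba], the exchange would lower the minimal distance. *)
Lemma stuck_exchange t x y rm ga ba : stuck t x y ->
  (forall e, e \in rm -> y e.1 e.2 + (count_mem e rm)%:Z <= x e.1 e.2) ->
  (forall e, e \in ga -> x e.1 e.2 + (count_mem e ga)%:Z <= y e.1 e.2) ->
  B (exchange (ga ++ ba) rm) -> (size rm + size ga <= size ba)%N.
Proof.
move=> [fx fy min_xy] rmP gaP Be.
rewrite -(leq_add2l (dist x y)) addnA; apply: leq_trans (dist_exchange ba rmP gaP).
by rewrite !leq_add2r min_xy //; [apply: walk_exchange rmP Be | apply: walk_refl].
Qed.

Lemma exchange_stuck t x y rm ga ba : stuck t x y ->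
  (forall e, e \in rm -> y e.1 e.2 + (count_mem e rm)%:Z <= x e.1 e.2) ->
  (forall e, e \in ga -> x e.1 e.2 + (count_mem e ga)%:Z <= y e.1 e.2) ->
  B (exchange (ga ++ ba) rm) -> (size ba <= size rm + size ga)%N ->
  stuck t (x + exchange (ga ++ ba) rm) y.
Proof.
move=> [fx fy min_xy] rmP gaP Be le_ba.
have wx := walk_exchange fx fy rmP Be; split=> // [|x' y' wx' wy'].
  exact: walk_fiber wx fx.
apply: leq_trans (min_xy _ _ (walk_trans wx wx') wy').
rewrite -(leq_add2r (size ba)); apply: leq_trans (dist_exchange ba rmP gaP).
by rewrite -addnA leq_add2l.
Qed.

End Walk.

Ltac delta_lia := apply/matrixP => ? ?; rewrite !mxE; do ?move: (_%:R); lia.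

Ltac perm_lia := apply/permP => ? /=; do ?move: (nat_of_bool _); lia.

(** * Pairs of tables at minimal distance *)

Section Stuck.
Context {R C N Q : nat} (r c : nat -> nat) (T : 'I_Q -> {set cell R C}).
Local Notation rho := (pblock (line_blocks N R r)).
Local Notation gam := (pblock (line_blocks N C c)).
Local Notation S := (\bigcup_(q < Q) T q)%SET.
Local Notation A := (configuration T).
Local Notation B := (moves A `&` typed_tables N r c S)%classic.
Implicit Types (i : 'I_R) (j : 'I_C) (q : 'I_Q) (x y z : table R C).

(** The argument sees the blocks only through the next four hypotheses, on the row block [rho i] and
    the column block [gam j]. By [T_match] the blocks of [S] are placed like the ones of a partial
    permutation matrix. *)
Hypothesis T_class : forall q i i' j j',
  rho i = rho i' -> gam j = gam j' -> ((i, j) \in T q) = ((i', j') \in T q).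
Hypothesis T_match : forall q q' i i' j j', (i, j) \in T q -> (i', j') \in T q' ->
  (rho i == rho i') = (gam j == gam j').
Hypothesis T_disj : forall q q' e, e \in T q -> e \in T q' -> q = q'.
Hypothesis blocks_inj : forall i i' j j',
  pblock (blocks N r c) (i, j) = pblock (blocks N r c) (i', j') ->
  rho i = rho i' /\ gam j = gam j'.

Lemma in_T_S q e : e \in T q -> e \in S.
Proof. by move=> Te; apply/bigcupP; exists q. Qed.

Lemma notin_S_T e q : e \notin S -> (e \in T q) = false.
Proof. by apply: contraNF => /in_T_S. Qed.

Lemma S_class i i' j j' :
  rho i = rho i' -> gam j = gam j' -> ((i, j) \in S) = ((i', j') \in S).
Proof.
move=> er eg; apply/bigcupP/bigcupP => -[q _ Te]; exists q => //.
  by rewrite -(T_class q er eg).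
by rewrite (T_class q er eg).
Qed.

Lemma S_match i i' j j' : (i, j) \in S -> (i', j') \in S ->
  (rho i == rho i') = (gam j == gam j').
Proof. by move=> /bigcupP[q _ Te] /bigcupP[q' _ Te']; apply: T_match Te Te'. Qed.

Lemma S_row_out i j j' : (i, j) \in S -> gam j' != gam j -> (i, j') \notin S.
Proof. by move=> Sij; apply: contraNN => /S_match /(_ Sij); rewrite eqxx => <-. Qed.

Lemma S_col_out i i' j : (i, j) \in S -> rho i' != rho i -> (i', j) \notin S.
Proof. by move=> Sij; apply: contraNN => /S_match /(_ Sij); rewrite eqxx => ->. Qed.

(** Why Types III and IV can preserve the subtable sums: their two cells in [S], of opposite signs,
    are taken in one [T q]. *)
Lemma T_color q q' e e' : e \in T q -> e' \in T q -> (e \in T q') = (e' \in T q').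
Proof.
by move=> Te Te'; apply/idP/idP => [/(T_disj Te) | /(T_disj Te')] <-.
Qed.

(** * The four types of moves as exchanges *)

(** Type I tables carry no condition on blocks; this one puts the swap of a rectangle into
    [moves]. *)
Definition balanced i i' j j' := forall q,
  (((i, j) \in T q) + ((i', j') \in T q) = ((i, j') \in T q) + ((i', j) \in T q))%N.

Lemma type1_exchange i1 i2 j1 j2 : i1 != i2 -> j1 != j2 -> balanced i1 i2 j1 j2 ->
  B (exchange [:: (i1, j1); (i2, j2)] [:: (i1, j2); (i2, j1)]).
Proof.
move=> ni nj bal; split.
  apply: exchange_moves => [||q] /=; rewrite ?addn0 //.
  by apply/permP => P /=; rewrite addnCA.
rewrite /typed_tables /=; apply: Or41; exists i1, i2, j1, j2; split=> //.
by rewrite /exchange /token_table !big_cons !big_nil !addr0 opprD !addrA.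
Qed.

Lemma type2_exchange i1 i2 i3 j1 j2 j3 :
  uniq [:: i1; i2; i3] -> uniq [:: j1; j2; j3] ->
  in_distinct_blocks N r c (~: S)
    [:: (i1, j2); (i2, j3); (i3, j1); (i1, j3); (i2, j1); (i3, j2)] ->
  B (exchange [:: (i1, j2); (i2, j3); (i3, j1)] [:: (i1, j3); (i2, j1); (i3, j2)]).
Proof.
move=> ui uj blk; split.
  apply: exchange_moves => [||q] /=; rewrite ?addn0 //.
    by perm_lia.
  have /andP[/and5P[]] := blk.
  rewrite !inE => o1 o2 o3 o4 /and3P[o5 o6 _] _.
  by rewrite !notin_S_T.
rewrite /typed_tables /=; apply: Or42.
exists i1, i2, i3, j1, j2, j3; split=> //.
by rewrite /exchange /token_table !big_cons !big_nil !addr0 !opprD !addrA.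
Qed.

Lemma type3_exchange q i1 i2 i3 j1 j2 j3 :
  uniq [:: i1; i2; i3] -> uniq [:: j1; j2; j3] ->
  (i1, j1) \in T q -> (i2, j2) \in T q ->
  in_distinct_blocks N r c S [:: (i1, j1); (i2, j2)] ->
  in_distinct_blocks N r c (~: S) [:: (i2, j3); (i3, j2); (i1, j3); (i3, j1)] ->
  B (exchange [:: (i1, j1); (i2, j3); (i3, j2)] [:: (i1, j3); (i2, j2); (i3, j1)]).
Proof.
move=> ui uj T1 T2 blkS blk; split.
  apply: exchange_moves => [||q'] /=; rewrite ?addn0 //.
    by perm_lia.
  have /andP[/and5P[]] := blk; rewrite !inE => o1 o2 o3 o4 _ _.
  by rewrite (T_color q' T1 T2) !(notin_S_T _ o1, notin_S_T _ o2, notin_S_T _ o3,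
    notin_S_T _ o4) !addn0.
rewrite /typed_tables /=; apply: Or43.
exists i1, i2, i3, j1, j2, j3; split=> //.
by rewrite /exchange /token_table !big_cons !big_nil !addr0 !opprD !addrA.
Qed.

Lemma type4_rows_exchange q i1 i2 i3 i4 j1 j2 j3 j4 :
  (i1, j1) \in T q -> (i3, j2) \in T q ->
  in_distinct_blocks N r c S [:: (i1, j1); (i3, j2)] ->
  cells_in (~: S)
    [:: (i2, j2); (i3, j3); (i4, j4); (i1, j3); (i2, j4); (i4, j1)] ->
  same_row_block N r i1 i2 -> same_row_block N r i3 i4 ->
  B (exchange [:: (i1, j1); (i2, j2); (i3, j3); (i4, j4)]
              [:: (i1, j3); (i2, j4); (i3, j2); (i4, j1)]).
Proof.
move=> T1 T2 blkS out r12 r34; split.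
  apply: exchange_moves => [||q'] /=; rewrite ?addn0 //.
    by perm_lia.
  have /and5P[] := out; rewrite !inE => o1 o2 o3 o4 /and3P[o5 o6 _].
  by rewrite (T_color q' T1 T2) !(notin_S_T _ o1, notin_S_T _ o2, notin_S_T _ o3,
    notin_S_T _ o4, notin_S_T _ o5, notin_S_T _ o6) !addn0.
rewrite /typed_tables /=; apply: Or44; left.
exists i1, i2, i3, i4, j1, j2, j3, j4; split=> //.
by rewrite /exchange /token_table !big_cons !big_nil !addr0 !opprD !addrA.
Qed.

Lemma type4_cols_exchange q i1 i2 i3 i4 j1 j2 j3 j4 :
  (i1, j1) \in T q -> (i2, j3) \in T q ->
  in_distinct_blocks N r c S [:: (i1, j1); (i2, j3)] ->
  cells_in (~: S)
    [:: (i2, j2); (i3, j3); (i4, j4); (i3, j1); (i4, j2); (i1, j4)] ->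
  same_col_block N c j1 j2 -> same_col_block N c j3 j4 ->
  B (exchange [:: (i1, j1); (i2, j2); (i3, j3); (i4, j4)]
              [:: (i3, j1); (i4, j2); (i2, j3); (i1, j4)]).
Proof.
move=> T1 T2 blkS out c12 c34; split.
  apply: exchange_moves => [||q'] /=; rewrite ?addn0 //.
    by perm_lia.
  have /and5P[] := out; rewrite !inE => o1 o2 o3 o4 /and3P[o5 o6 _].
  by rewrite (T_color q' T1 T2) !(notin_S_T _ o1, notin_S_T _ o2, notin_S_T _ o3,
    notin_S_T _ o4, notin_S_T _ o5, notin_S_T _ o6) !addn0.
rewrite /typed_tables /=; apply: Or44; right.
exists i1, i2, i3, i4, j1, j2, j3, j4; split=> //.
by rewrite /exchange /token_table !big_cons !big_nil !addr0 !opprD !addrA.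
Qed.

Lemma in_distinct_blocks_perm (D : {set cell R C}) s s' :
  perm_eq s s' -> in_distinct_blocks N r c D s = in_distinct_blocks N r c D s'.
Proof.
by move=> ss'; rewrite /in_distinct_blocks /cells_in (perm_all _ ss')
  (perm_uniq (perm_map _ ss')).
Qed.

(** Relabelling turns positive cells into negative ones: swap the columns for Type I, the indices 2
    and 3 for Type II, 1 and 2 for Type III; for Type IV by rows, swap [j1] with [j2] and the pair
    [i1], [i2] with [i3], [i4]. *)
Lemma typed_tablesN z : typed_tables N r c S z -> typed_tables N r c S (- z).
Proof.
rewrite /typed_tables /=; case=> [[i1 [i2 [j1 [j2 [ni nj ->]]]]]
       |[i1 [i2 [i3 [j1 [j2 [j3 [ui uj blk ->]]]]]]]
       |[i1 [i2 [i3 [j1 [j2 [j3 [ui uj blkS blk ->]]]]]]]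
       |[[i1 [i2 [i3 [i4 [j1 [j2 [j3 [j4 [blkS out r12 r34 ->]]]]]]]]]
        |[i1 [i2 [i3 [i4 [j1 [j2 [j3 [j4 [blkS out r12 r34 ->]]]]]]]]]]].
- apply: Or41; exists i1, i2, j2, j1; split=> //; first by rewrite eq_sym.
  by delta_lia.
- apply: Or42; exists i1, i3, i2, j1, j3, j2; split.
  + by rewrite (perm_uniq (_ : perm_eq _ [:: i1; i2; i3])) //; perm_lia.
  + by rewrite (perm_uniq (_ : perm_eq _ [:: j1; j2; j3])) //; perm_lia.
  + rewrite (in_distinct_blocks_perm _ (_ : perm_eq _
      [:: (i1, j2); (i2, j3); (i3, j1); (i1, j3); (i2, j1); (i3, j2)])) //.
    by perm_lia.
  + by delta_lia.
- apply: Or43; exists i2, i1, i3, j2, j1, j3; split.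
  + by rewrite (perm_uniq (_ : perm_eq _ [:: i1; i2; i3])) //; perm_lia.
  + by rewrite (perm_uniq (_ : perm_eq _ [:: j1; j2; j3])) //; perm_lia.
  + rewrite (in_distinct_blocks_perm _ (_ : perm_eq _
      [:: (i1, j1); (i2, j2)])) //.
    by perm_lia.
  + rewrite (in_distinct_blocks_perm _ (_ : perm_eq _
      [:: (i2, j3); (i3, j2); (i1, j3); (i3, j1)])) //.
    by perm_lia.
  + by delta_lia.
- apply: Or44; left; exists i3, i4, i1, i2, j2, j1, j3, j4; split=> //.
  + rewrite (in_distinct_blocks_perm _ (_ : perm_eq _
      [:: (i1, j1); (i3, j2)])) //.
    by perm_lia.
  + rewrite /cells_in (perm_all _ (_ : perm_eq _
      [:: (i2, j2); (i3, j3); (i4, j4); (i1, j3); (i2, j4); (i4, j1)])) //.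
    by perm_lia.
  + by delta_lia.
- apply: Or44; right; exists i2, i1, i3, i4, j3, j4, j1, j2; split=> //.
  + rewrite (in_distinct_blocks_perm _ (_ : perm_eq _
      [:: (i1, j1); (i2, j3)])) //.
    by perm_lia.
  + rewrite /cells_in (perm_all _ (_ : perm_eq _
      [:: (i2, j2); (i3, j3); (i4, j4); (i3, j1); (i4, j2); (i1, j4)])) //.
    by perm_lia.
  + by delta_lia.
Qed.

Lemma typed_moves_opp z : B z -> B (- z).
Proof.
case=> mz tz; split; last exact: typed_tablesN.
by move: mz; rewrite /moves /= statisticN => ->; rewrite oppr0.
Qed.

Lemma typed_moves_statistic z : B z -> statistic A z = 0.
Proof. by case. Qed.

(** * Sign patterns excluded for a stuck pair *)

Section StuckPair.
Variable t : 'cV[int]_(R + C + Q).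
Local Notation stuck := (stuck A B t).

Lemma stuck_sums x y : stuck x y ->
  [/\ forall i, \sum_j x i j = \sum_j y i j,
      forall j, \sum_i x i j = \sum_i y i j
    & forall q, \sum_(e in T q) x e.1 e.2 = \sum_(e in T q) y e.1 e.2].
Proof. by case=> -[_ xt] [_ yt] _; apply/eq_statistic; rewrite xt yt. Qed.

Lemma row_sign_change x y i j :
  stuck x y -> x i j < y i j -> exists j', y i j' < x i j'.
Proof. by case/stuck_sums=> eqr _ _ /(sumr_sign_change (eqr i) isT)[j' _]; exists j'. Qed.

Lemma col_sign_change x y i j :
  stuck x y -> x i j < y i j -> exists i', y i' j < x i' j.
Proof. by case/stuck_sums=> _ eqc _ /(sumr_sign_change (eqc j) isT)[i' _]; exists i'. Qed.

(** Alternating signs at three corners make the swap of the rectangle shortening, so it cannot be a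
    move. *)
Lemma L_shape_unbalanced x y i i' j j' : stuck x y ->
  y i j < x i j -> x i j' < y i j' -> y i' j' < x i' j' ->
  ~ balanced i i' j' j.
Proof.
move=> st rm1 ga1 rm2 bal.
have ni : i != i' by apply: contraTneq rm2 => <-; rewrite -leNgt ltW.
have nj : j' != j by apply: contraTneq rm1 => <-; rewrite -leNgt ltW.
(* Two removed tokens and one good added token against one bad one; the similar goals below count in
   the same way. *)
suff : (2 + 1 <= 1)%N by [].
apply: (@stuck_exchange _ _ _ _ _ typed_moves_statistic _ _ _
  [:: (i, j); (i', j')]
  [:: (i, j')] [:: (i', j)] st); last exact: type1_exchange.
- by apply: lt_uniq_count; rewrite /= ?rm1 ?rm2 // inE xpair_eqE negb_and ni.
- by apply: lt_uniq_count; rewrite //= ga1.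
Qed.

(** A rectangle with both columns in one block is balanced, as membership in [T q] depends only on
    blocks; the sum of column [j] supplies the third corner. *)
Lemma same_row_signs x y i j j' : stuck x y -> gam j = gam j' ->
  x i j < y i j -> x i j' <= y i j'.
Proof.
move=> st eg lt_j; rewrite leNgt; apply/negP=> lt_j'.
have [i' lt_i'] := col_sign_change st lt_j.
apply: (L_shape_unbalanced st lt_j' lt_j lt_i') => q.
by rewrite (T_class q (erefl (rho i)) eg) (T_class q (erefl (rho i')) eg).
Qed.

Lemma same_col_signs x y i i' j : stuck x y -> rho i = rho i' ->
  x i j < y i j -> x i' j <= y i' j.
Proof.
move=> st er lt_i; rewrite leNgt; apply/negP=> lt_i'.
have [j' lt_j'] := row_sign_change st lt_i.
apply: (L_shape_unbalanced st lt_j' lt_i lt_i') => q.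
by rewrite addnC (T_class q er (erefl (gam j))) (T_class q er (erefl (gam j'))).
Qed.

(* The first exchange does not increase the distance and creates two entries  *)
(* of opposite signs in row i and in one column block.                        *)
Lemma same_block_signs x y i i' j j' : stuck x y ->
  rho i = rho i' -> gam j = gam j' -> x i j < y i j -> x i' j' <= y i' j'.
Proof.
move=> st er eg lt1; rewrite leNgt; apply/negP=> lt2.
(* With [ge12], the tables agree at [(i, j')], so a token added there creates an excess. *)
have le12 : x i j' <= y i j' by apply: same_row_signs eg lt1.
have ge12 : y i j' <= x i j'.
  by apply: same_col_signs (stuck_sym st) (esym er) lt2.
have le21 : x i' j <= y i' j by apply: same_col_signs er lt1.
have [k lt_k] := row_sign_change st lt1.
have ni : i' != i by apply: contraTneq lt2 => ->; rewrite -leNgt.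
have nj : j' != j by apply: contraTneq lt2 => ->; rewrite -leNgt.
have nkj : k != j by apply: contraTneq lt1 => <-; rewrite -leNgt ltW.
have nkj' : k != j' by apply: contraTneq lt_k => ->; rewrite -leNgt.
have bal : balanced i' i k j'.
  move=> q; rewrite addnC.
  by rewrite (T_class q er (erefl (gam k))) (T_class q er (erefl (gam j')))
    addnC.
have st' := @exchange_stuck _ _ _ _ _ typed_moves_statistic _ _ _
  [:: (i', j'); (i, k)]
  [::] [:: (i', k); (i, j')] st _ _ (type1_exchange ni nkj' bal) isT.
have {}st' : stuck (x + exchange [:: (i', k); (i, j')] [:: (i', j'); (i, k)]) y.
  apply: st' => //; apply: lt_uniq_count; rewrite /= ?lt2 ?lt_k //.
  by rewrite inE xpair_eqE negb_and ni.
suff /(same_row_signs st' eg) :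
    (x + exchange [:: (i', k); (i, j')] [:: (i', j'); (i, k)]) i j < y i j.
  rewrite !mxE !token_tableE /= !xpair_eqE !eqxx (negPf ni) (negPf nkj') /=.
  lia.
by rewrite !mxE !token_tableE /= !xpair_eqE (negPf ni) (negPf nkj) (negPf nj)
  !andbF /= subrr addr0.
Qed.

(** Three removed tokens and the one added at [(i1, j1)] beat the two at [(i2, j3)] and [(i3, j2)],
    which the last two inequalities keep outside [S]. *)
Lemma no_type3 x y q i1 i2 i3 j1 j2 j3 : stuck x y ->
  (i1, j1) \in T q -> (i2, j2) \in T q -> rho i1 != rho i2 ->
  x i1 j1 < y i1 j1 -> y i2 j2 < x i2 j2 ->
  y i1 j3 < x i1 j3 -> y i3 j1 < x i3 j1 ->
  gam j3 != gam j2 -> rho i3 != rho i2 -> False.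
Proof.
move=> st T1 T2 nr12 lt1 lt2 lt13 lt31 ng32 nr32.
have ng12 : gam j1 != gam j2 by rewrite -(T_match T1 T2).
have ng31 : gam j3 != gam j1.
  by apply: contraTneq lt13 => eg; rewrite -leNgt (same_row_signs st (esym eg)).
have nr31 : rho i3 != rho i1.
  by apply: contraTneq lt31 => er; rewrite -leNgt (same_col_signs st (esym er)).
have ni12 : i1 != i2 by apply: contraNneq nr12 => ->.
have ni13 : i1 != i3 by apply: contraNneq nr31 => ->.
have ni23 : i2 != i3 by apply: contraNneq nr32 => ->.
have nj12 : j1 != j2 by apply: contraNneq ng12 => ->.
have nj13 : j1 != j3 by apply: contraNneq ng31 => ->.
have nj23 : j2 != j3 by apply: contraNneq ng32 => ->.
suff : (3 + 1 <= 2)%N by [].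
apply: (@stuck_exchange _ _ _ _ _ typed_moves_statistic _ _ _
  [:: (i1, j3); (i2, j2); (i3, j1)]
  [:: (i1, j1)] [:: (i2, j3); (i3, j2)] st).
- apply: lt_uniq_count; last by rewrite /= lt13 lt2 lt31.
  apply: (@map_uniq _ _ fst).
  by rewrite /= !inE !negb_or ni12 ni13 ni23.
- by apply: lt_uniq_count; rewrite //= lt1.
apply: (type3_exchange _ _ T1 T2).
- by rewrite /= !inE !negb_or ni12 ni13 ni23.
- by rewrite /= !inE !negb_or nj12 nj13 nj23.
- rewrite /in_distinct_blocks /= !(in_T_S T1, in_T_S T2) /= inE andbT.
  by apply: contraNneq nr12 => /blocks_inj[->].
have S1 := in_T_S T1; have S2 := in_T_S T2.
rewrite /in_distinct_blocks /= !inE (S_row_out S2) // (S_col_out S2) //.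
rewrite (S_row_out S1) // (S_col_out S1) //= !negb_or -!andbA andbT.
apply/and5P; split; last (apply/andP; split);
  [apply: contraNneq nr32 | apply: contraNneq nr12 | apply: contraNneq nr32
  | apply: contraNneq nr31 | apply: contraNneq ng12 | apply: contraNneq nr31];
  by move=> /blocks_inj[er eg]; rewrite ?er ?eg.
Qed.

(** The shortages in rows [i1] and [i2] yield excesses in columns [j3] and [j4]; only the tokens
    added at [(i3, j3)] and [(i4, j4)] may be bad. *)
Lemma no_type4_rows x y q i1 i2 i3 i4 j1 j2 : stuck x y ->
  (i1, j1) \in T q -> (i3, j2) \in T q -> rho i1 != rho i3 ->
  rho i1 = rho i2 -> rho i3 = rho i4 ->
  x i1 j1 < y i1 j1 -> y i3 j2 < x i3 j2 ->
  x i2 j2 < y i2 j2 -> y i4 j1 < x i4 j1 -> False.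
Proof.
move=> st T1 T3 nr13 r12 r34 lt11 lt32 lt22 lt41.
have ng12 : gam j1 != gam j2 by rewrite -(T_match T1 T3).
have nj12 : j1 != j2 by apply: contraNneq ng12 => ->.
have ni13 : i1 != i3 by apply: contraNneq nr13 => ->.
have ni14 : i1 != i4 by apply: contraNneq nr13 => ->; rewrite r34.
have ni23 : i2 != i3 by apply: contraNneq nr13 => <-; rewrite r12.
have ni24 : i2 != i4 by apply: contraNneq nr13; rewrite r12 r34 => ->.
(* When [i1 = i2], the two cells may coincide if the excess allows it; the move is then not
   square-free. *)
have [j3 [j4 [lt13 lt24 dbl]]] : exists j3 j4, [/\ y i1 j3 < x i1 j3,
    y i2 j4 < x i2 j4 & (i1, j3) = (i2, j4) -> y i1 j3 + 2 <= x i1 j3].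
  have [eqr _ _] := stuck_sums st.
  have [e12|n12] := eqVneq i1 i2.
    rewrite -e12 in lt22 *.
    have [j3 [j4 [lt3 lt4 dbl]]] := sumr_two_sign_changes (eqr i1) nj12 lt11 lt22.
    by exists j3, j4; split=> // -[].
  have [j3 lt3] := row_sign_change st lt11.
  have [j4 lt4] := row_sign_change st lt22.
  by exists j3, j4; split=> // -[e12 _]; rewrite e12 eqxx in n12.
have ng31 : gam j3 != gam j1.
  by apply: contraTneq lt13 => eg; rewrite -leNgt (same_row_signs st (esym eg)).
have ng41 : gam j4 != gam j1.
  apply: contraTneq lt24 => eg.
  by rewrite -leNgt (same_block_signs st r12 (esym eg)).
have ng32 : gam j3 != gam j2.
  apply: contraTneq lt13 => eg.
  by rewrite -leNgt (same_block_signs st (esym r12) (esym eg)).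
have ng42 : gam j4 != gam j2.
  by apply: contraTneq lt24 => eg; rewrite -leNgt (same_row_signs st (esym eg)).
have [S1 S3] := (in_T_S T1, in_T_S T3).
suff : (4 + 2 <= 2)%N by [].
apply: (@stuck_exchange _ _ _ _ _ typed_moves_statistic _ _ _
  [:: (i1, j3); (i2, j4); (i3, j2); (i4, j1)]
  [:: (i1, j1); (i2, j2)] [:: (i3, j3); (i4, j4)] st).
- apply: lt_pair_count; rewrite /= ?lt13 ?lt24 ?lt32 ?lt41 // !inE !xpair_eqE.
  + by rewrite (eq_sym j2) (negPf nj12) andbF.
  + by rewrite (negPf ni13) (negPf ni14).
  + by rewrite (negPf ni23) (negPf ni24).
- apply: lt_uniq_count; last by rewrite /= lt11 lt22.
  by apply: (@map_uniq _ _ snd); rewrite /= inE nj12.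
apply: (type4_rows_exchange T1 T3); last 2 first.
- exact/eqP.
- exact/eqP.
- rewrite /in_distinct_blocks /= S1 S3 /= inE andbT.
  by apply: contraNneq nr13 => /blocks_inj[->].
rewrite /cells_in /= !inE (S_row_out S1) // -(S_class r12 (erefl (gam j4))).
rewrite (S_row_out S1) // -(S_class r12 (erefl (gam j2))) (S_row_out S1) 1?eq_sym //.
rewrite (S_row_out S3) // -(S_class r34 (erefl (gam j4))) (S_row_out S3) //.
by rewrite -(S_class r34 (erefl (gam j1))) (S_row_out S3).
Qed.

(** The transpose of [no_type4_rows]: columns [j1] and [j2] now supply the rows [i3] and [i4]. *)
Lemma no_type4_cols x y q i1 i2 j1 j2 j3 j4 : stuck x y ->
  (i1, j1) \in T q -> (i2, j3) \in T q -> rho i1 != rho i2 ->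
  gam j1 = gam j2 -> gam j3 = gam j4 ->
  x i1 j1 < y i1 j1 -> y i2 j3 < x i2 j3 ->
  x i2 j2 < y i2 j2 -> y i1 j4 < x i1 j4 -> False.
Proof.
move=> st T1 T3 nr12 g12 g34 lt11 lt23 lt22 lt14.
have ng13 : gam j1 != gam j3 by rewrite -(T_match T1 T3).
have ni12 : i1 != i2 by apply: contraNneq nr12 => ->.
have nj13 : j1 != j3 by apply: contraNneq ng13 => ->.
have nj14 : j1 != j4 by apply: contraNneq ng13 => ->; rewrite g34.
have nj23 : j2 != j3 by apply: contraNneq ng13 => <-; rewrite g12.
have nj24 : j2 != j4 by apply: contraNneq ng13; rewrite g12 g34 => ->.
have [i3 [i4 [lt31 lt42 dbl]]] : exists i3 i4, [/\ y i3 j1 < x i3 j1,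
    y i4 j2 < x i4 j2 & (i3, j1) = (i4, j2) -> y i3 j1 + 2 <= x i3 j1].
  have [_ eqc _] := stuck_sums st.
  have [e12|n12] := eqVneq j1 j2.
    rewrite -e12 in lt22 *.
    have [i3 [i4 [lt3 lt4 dbl]]] := sumr_two_sign_changes (eqc j1) ni12 lt11 lt22.
    by exists i3, i4; split=> // -[].
  have [i3 lt3] := col_sign_change st lt11.
  have [i4 lt4] := col_sign_change st lt22.
  by exists i3, i4; split=> // -[_ e12]; rewrite e12 eqxx in n12.
have nr31 : rho i3 != rho i1.
  by apply: contraTneq lt31 => er; rewrite -leNgt (same_col_signs st (esym er)).
have nr41 : rho i4 != rho i1.
  apply: contraTneq lt42 => er.
  by rewrite -leNgt (same_block_signs st (esym er) g12).
have nr32 : rho i3 != rho i2.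
  apply: contraTneq lt31 => er.
  by rewrite -leNgt (same_block_signs st (esym er) (esym g12)).
have nr42 : rho i4 != rho i2.
  by apply: contraTneq lt42 => er; rewrite -leNgt (same_col_signs st (esym er)).
have [S1 S3] := (in_T_S T1, in_T_S T3).
suff : (4 + 2 <= 2)%N by [].
apply: (@stuck_exchange _ _ _ _ _ typed_moves_statistic _ _ _
  [:: (i3, j1); (i4, j2); (i2, j3); (i1, j4)]
  [:: (i1, j1); (i2, j2)] [:: (i3, j3); (i4, j4)] st).
- apply: lt_pair_count; rewrite /= ?lt31 ?lt42 ?lt23 ?lt14 // !inE !xpair_eqE.
  + by rewrite (eq_sym i2) (negPf ni12).
  + by rewrite (negPf nj13) (negPf nj14) !andbF.
  + by rewrite (negPf nj23) (negPf nj24) !andbF.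
- apply: lt_uniq_count; last by rewrite /= lt11 lt22.
  by apply: (@map_uniq _ _ fst); rewrite /= inE ni12.
apply: (type4_cols_exchange T1 T3); last 2 first.
- exact/eqP.
- exact/eqP.
- rewrite /in_distinct_blocks /= S1 S3 /= inE andbT.
  by apply: contraNneq nr12 => /blocks_inj[->].
rewrite /cells_in /= !inE (S_col_out S1) // -(S_class (erefl (rho i4)) g12).
rewrite (S_col_out S1) // -(S_class (erefl (rho i2)) g12) (S_col_out S1) 1?eq_sym //.
rewrite (S_col_out S3) // -(S_class (erefl (rho i4)) g34) (S_col_out S3) //.
by rewrite -(S_class (erefl (rho i1)) g34) (S_col_out S3).
Qed.

Lemma le_on_S x y i j : stuck x y -> (i, j) \in S -> y i j <= x i j.
Proof.
move=> st /bigcupP[q _ T1]; rewrite leNgt; apply/negP=> lt1.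
have [_ _ eqT] := stuck_sums st.
have [[i2 j2] /= T2 lt2] := sumr_sign_change (eqT q) T1 lt1.
(* By [T_match], equal row blocks would put both cells, of opposite signs, in one block. *)
have nr12 : rho i != rho i2.
  apply: contraTneq lt2 => er; rewrite -leNgt (same_block_signs st er _ lt1) //.
  by apply/eqP; rewrite -(T_match T1 T2) er.
have nr21 : rho i2 != rho i by rewrite eq_sym.
have [j3 lt3] := row_sign_change st lt1.
have [i3 lt3'] := col_sign_change st lt1.
have st' := stuck_sym st.
have [j4 lt4] := row_sign_change st' lt2.
have [i4 lt4'] := col_sign_change st' lt2.
(* Without a Type III exchange on [x] or [y], an excess and a shortage each lie in one of the two
   blocks off [S] that complete the rectangle. The same block for both contradicts
   [same_block_signs]; different blocks give Type IV. *)
have [g3|ng3] := eqVneq (gam j3) (gam j2).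
  have [g4|ng4] := eqVneq (gam j4) (gam j).
    exact: (no_type4_cols st T1 T2 nr12 (esym g4) (esym g3)).
  have [r4|nr4] := eqVneq (rho i4) (rho i).
    by have := same_block_signs st r4 (esym g3) lt4'; rewrite leNgt lt3.
  exact: (no_type3 st' T2 T1 nr21 lt2 lt1 lt4 lt4' ng4 nr4).
have [r3|nr3] := eqVneq (rho i3) (rho i2); last first.
  exact: (no_type3 st T1 T2 nr12 lt1 lt2 lt3 lt3' ng3 nr3).
have [r4|nr4] := eqVneq (rho i4) (rho i).
  exact: (no_type4_rows st T1 T2 nr12 (esym r4) (esym r3)).
have [g4|ng4] := eqVneq (gam j4) (gam j).
  by have := same_block_signs st (esym r3) g4 lt4; rewrite leNgt lt3'.
exact: (no_type3 st' T2 T1 nr21 lt2 lt1 lt4 lt4' ng4 nr4).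
Qed.

Lemma eq_on_S x y i j : stuck x y -> (i, j) \in S -> x i j = y i j.
Proof.
by move=> st Sij; apply/eqP; rewrite eq_le !le_on_S //; apply: stuck_sym.
Qed.

(** The tables agree on [S], so the three given corners are outside it; with the fourth outside too,
    the rectangle would meet no [T q] and be balanced. *)
Lemma L_shape_in_S x y i i' j j' : stuck x y ->
  y i j < x i j -> x i j' < y i j' -> y i' j' < x i' j' -> (i', j) \in S.
Proof.
move=> st lt1 lt2 lt3; apply: contraT => nS.
have out a b : x a b != y a b -> (a, b) \notin S.
  by apply: contraNN => /(eq_on_S st) ->.
case: (L_shape_unbalanced st lt1 lt2 lt3) => q.
have o1 := out _ _ (negbT (gt_eqF lt1)); have o2 := out _ _ (negbT (lt_eqF lt2)).
by have o3 := out _ _ (negbT (gt_eqF lt3)); rewrite !notin_S_T.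
Qed.

(** A shortage at [(i1, j2)] extends to five alternating cells of a hexagon. [L_shape_in_S] puts
    [(i1, j1)], [(i2, j2)], [(i3, j3)] in [S], which separates the blocks of the rows and of the
    columns. Only the sixth cell [(i3, j1)] has unknown sign. *)
Lemma stuck_le x y i j : stuck x y -> y i j <= x i j.
Proof.
move=> st; rewrite leNgt; apply/negP=> lt12.
have st' := stuck_sym st.
move: i j lt12 => i1 j2 lt12.
have [j3 lt13] := row_sign_change st lt12.
have [i3 lt32] := col_sign_change st lt12.
have S33 := L_shape_in_S st lt13 lt12 lt32.
have [i2 lt23] := col_sign_change st' lt13.
have S22 := L_shape_in_S st' lt12 lt13 lt23.
have [j1 lt21] := row_sign_change st lt23.
have S11 := L_shape_in_S st lt21 lt23 lt13.
have out a b : x a b != y a b -> (a, b) \notin S.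
  by apply: contraNN => /(eq_on_S st) ->.
have o12 := out _ _ (negbT (lt_eqF lt12)).
have o23 := out _ _ (negbT (lt_eqF lt23)).
have o13 := out _ _ (negbT (gt_eqF lt13)).
have o21 := out _ _ (negbT (gt_eqF lt21)).
have o32 := out _ _ (negbT (gt_eqF lt32)).
(* In one row, a cell in [S] and a cell outside [S] have different column blocks. *)
have g12 : gam j1 != gam j2.
  by apply: contraNneq o12 => eg; rewrite -(S_class (erefl (rho i1)) eg).
have g13 : gam j1 != gam j3.
  by apply: contraNneq o13 => eg; rewrite -(S_class (erefl (rho i1)) eg).
have g23 : gam j2 != gam j3.
  by apply: contraNneq o23 => eg; rewrite -(S_class (erefl (rho i2)) eg).
have r12 : rho i1 != rho i2 by rewrite (S_match S11 S22).
have r13 : rho i1 != rho i3 by rewrite (S_match S11 S33).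
have r23 : rho i2 != rho i3 by rewrite (S_match S22 S33).
have o31 : (i3, j1) \notin S by apply: (S_row_out S33).
have ui : uniq [:: i1; i2; i3].
  by apply: (@map_uniq _ _ rho); rewrite /= !inE !negb_or r12 r13 r23.
have uj : uniq [:: j1; j2; j3].
  by apply: (@map_uniq _ _ gam); rewrite /= !inE !negb_or g12 g13 g23.
suff : (3 + 2 <= 1)%N by [].
apply: (@stuck_exchange _ _ _ _ _ typed_moves_statistic _ _ _
  [:: (i1, j3); (i2, j1); (i3, j2)] [:: (i1, j2); (i2, j3)] [:: (i3, j1)] st).
- apply: lt_uniq_count; last by rewrite /= lt13 lt21 lt32.
  exact: (@map_uniq _ _ fst).
- apply: lt_uniq_count; last by rewrite /= lt12 lt23.
  apply: (@map_uniq _ _ fst).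
  by move: ui; rewrite /= !inE negb_or -andbA => /and3P[->].
apply: type2_exchange => //.
rewrite /in_distinct_blocks /= !inE o12 o23 o31 o13 o21 o32 /= andbT.
have sep a b a' b' : (rho a != rho a') || (gam b != gam b') ->
    (pblock (blocks N r c) (a, b) == pblock (blocks N r c) (a', b')) = false.
  by rewrite -negb_and; apply: contraNF => /eqP/blocks_inj[-> ->]; rewrite !eqxx.
by rewrite !sep // ?(r12, r13, r23, g12, g13, g23, eq_sym (rho i3), eq_sym (rho i2),
  eq_sym (gam j3), eq_sym (gam j2)) ?orbT.
Qed.

Lemma stuck_eq x y : stuck x y -> x = y.
Proof.
move=> st; apply/matrixP=> i j; apply/eqP; rewrite eq_le !stuck_le //.
exact: stuck_sym.
Qed.

End StuckPair.

Lemma typed_moves_connect : connects A B.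
Proof. by apply: stuck_connects => [z /typed_moves_opp | t x y /stuck_eq]. Qed.

End Stuck.

(** * The blocks cut out by r and c *)

Section LineBlocks.
Context {n N : nat} {s : nat -> nat}.
Hypothesis s0 : s 0%N = 0%N.
Hypothesis s_lt : forall k, (k < N)%N -> (s k < s k.+1)%N.
Local Notation band k := [set i : 'I_n | (s k <= i < s k.+1)%N].

Lemma cut_le k l : (k <= l <= N)%N -> (s k <= s l)%N.
Proof.
case/andP=> /subnK <-; elim: (l - k)%N => // m IH lt_N.
by apply: leq_trans (IH (ltnW lt_N)) (ltnW (s_lt _)).
Qed.

Lemma band_inj (k l : 'I_N) (i : 'I_n) : i \in band k -> i \in band l -> k = l.
Proof.
rewrite !inE => /andP[k1 k2] /andP[l1 l2].
have [lt_kl|lt_lk|/ord_inj //] := ltngtP k l.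
  have := @cut_le k.+1 l; rewrite lt_kl ltnW // => /(_ isT) le_s.
  by have := leq_trans k2 (leq_trans le_s l1); rewrite ltnn.
have := @cut_le l.+1 k; rewrite lt_lk ltnW // => /(_ isT) le_s.
by have := leq_trans l2 (leq_trans le_s k1); rewrite ltnn.
Qed.

Lemma band_line_blocks (k : 'I_N) : band k \in line_blocks N n s.
Proof. by rewrite inE; apply/orP; left; apply/imsetP; exists k. Qed.

Lemma line_blocks_trivIset : trivIset (line_blocks N n s).
Proof.
have disj i (X Y : {set 'I_n}) : X \in line_blocks N n s ->
    Y \in line_blocks N n s -> i \in X -> i \in Y -> X = Y.
  have last_out (k : 'I_N) : i \in band k -> (s N <= i)%N -> False.
    rewrite inE => /andP[_ lt_s] le_s; have := @cut_le k.+1 N.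
    rewrite ltn_ord leqnn => /(_ isT) le_sk.
    by have := leq_trans lt_s (leq_trans le_sk le_s); rewrite ltnn.
  rewrite !inE => /orP[/imsetP[k _ ->]|/andP[_ /eqP->]]
    /orP[/imsetP[l _ ->]|/andP[_ /eqP->]] //.
  - by move=> ik il; rewrite (band_inj ik il).
  - by move=> ik; rewrite inE => /(last_out _ ik).
  - by rewrite inE => + ik => /(last_out _ ik).
apply/trivIsetP=> X Y PX PY; apply: contraNT => /pred0Pn[i /= /andP[iX iY]].
by apply/eqP; apply: disj iX iY.
Qed.

Lemma line_blocks_cover (i : 'I_n) : i \in cover (line_blocks N n s).
Proof.
have [lt_i|le_i] := ltnP i (s N); last first.
  apply/bigcupP; exists [set i : 'I_n | (s N <= i)%N]; last by rewrite inE.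
  rewrite !inE eqxx andbT; apply/orP; right; apply/set0Pn.
  by exists i; rewrite inE.
(* Lower [N] until its cut point no longer exceeds [i]; [s0] rules out the base case. *)
have [k le_k lt_k] : exists2 k : 'I_N, (s k <= i)%N & (i < s k.+1)%N.
  elim: N lt_i => [|M IH]; first by rewrite s0.
  have [lt_i _|le_i lt_i] := ltnP i (s M); last by exists ord_max.
  by have [k] := IH lt_i; exists (widen_ord (leqnSn M) k).
apply/bigcupP; exists (band k); first exact: band_line_blocks.
by rewrite inE le_k.
Qed.

Lemma mem_line_block (i : 'I_n) : i \in pblock (line_blocks N n s) i.
Proof. by rewrite mem_pblock line_blocks_cover. Qed.

Lemma band_pblock (k : 'I_N) (i : 'I_n) :
  i \in band k -> pblock (line_blocks N n s) i = band k.
Proof.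
by apply: def_pblock; [exact: line_blocks_trivIset | exact: band_line_blocks].
Qed.

Lemma band_class (k : 'I_N) (i i' : 'I_n) :
  pblock (line_blocks N n s) i = pblock (line_blocks N n s) i' ->
  (i \in band k) = (i' \in band k).
Proof.
move=> eqp; apply/idP/idP=> /band_pblock <-; first by rewrite eqp mem_line_block.
by rewrite -eqp mem_line_block.
Qed.

Lemma band_pblock_eq (k l : 'I_N) (i i' : 'I_n) : i \in band k -> i' \in band l ->
  (pblock (line_blocks N n s) i == pblock (line_blocks N n s) i') = (k == l).
Proof.
move=> ik i'l; apply/eqP/eqP=> [eqp | ekl].
  by apply: band_inj (_ : i' \in _) i'l; rewrite -(band_class k eqp).
by rewrite (band_pblock ik) (band_pblock i'l) ekl.
Qed.

End LineBlocks.

(** * Product blocks and the subtables *)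

Section BlocksOfCells.
Context {R C N : nat} (r c : nat -> nat).
Hypotheses (r0 : r 0%N = 0%N) (c0 : c 0%N = 0%N).
Hypothesis r_lt : forall k, (k < N)%N -> (r k < r k.+1)%N.
Hypothesis c_lt : forall k, (k < N)%N -> (c k < c k.+1)%N.
Local Notation rho := (pblock (line_blocks N R r)).
Local Notation gam := (pblock (line_blocks N C c)).
Implicit Types (i : 'I_R) (j : 'I_C).

Lemma blocks_trivIset : trivIset (@blocks R C N r c).
Proof.
have Tr : trivIset (line_blocks N R r) := line_blocks_trivIset r_lt.
have Tc : trivIset (line_blocks N C c) := line_blocks_trivIset c_lt.
apply/trivIsetP=> _ _ /imset2P[X Y PX PY ->] /imset2P[X' Y' PX' PY' ->].
apply: contraNT => /pred0Pn[[i j] /=]; rewrite !inE /=.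
move=> /andP[/andP[iX jY] /andP[iX' jY']]; apply/eqP; congr setX.
  by rewrite -(def_pblock Tr PX iX) -(def_pblock Tr PX' iX').
by rewrite -(def_pblock Tc PY jY) -(def_pblock Tc PY' jY').
Qed.

Lemma pblock_blocks i j : pblock (blocks N r c) (i, j) = setX (rho i) (gam j).
Proof.
have ci : i \in cover (line_blocks N R r) := line_blocks_cover r0 i.
have cj : j \in cover (line_blocks N C c) := line_blocks_cover c0 j.
apply: def_pblock; first exact: blocks_trivIset.
  by apply/imset2P; exists (rho i) (gam j) => //; apply: pblock_mem.
by rewrite inE /= !mem_pblock ci.
Qed.

Lemma pblock_blocks_inj i i' j j' :
  pblock (blocks N r c) (i, j) = pblock (blocks N r c) (i', j') ->
  rho i = rho i' /\ gam j = gam j'.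
Proof.
rewrite !pblock_blocks => eqX.
have : (i, j) \in setX (rho i') (gam j').
  by rewrite -eqX inE /= !mem_line_block.
rewrite inE /= => /andP[ii' jj']; split; apply: same_pblock => //.
  exact: line_blocks_trivIset r_lt.
exact: line_blocks_trivIset c_lt.
Qed.

Section Subtables.
Context {Q : nat} (Nhat : 'I_Q -> {set 'I_N}).
Hypothesis Nhat_disj :
  forall q q' : 'I_Q, (q < q')%N -> [disjoint Nhat q & Nhat q'].
Local Notation T := (@subtable R C N r c Q Nhat).
Implicit Types q : 'I_Q.

Lemma subtableP q i j :
  reflect (exists2 n, n \in Nhat q &
             (i \in [set i : 'I_R | (r n <= i < r n.+1)%N]) /\
             (j \in [set j : 'I_C | (c n <= j < c n.+1)%N]))
          ((i, j) \in T q).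
Proof.
apply: (iffP bigcupP) => -[n nq]; rewrite !inE.
  by case/andP=> ? ?; exists n => //; rewrite !inE.
by case=> ? ?; exists n => //; rewrite inE; apply/andP.
Qed.

Lemma subtable_class q i i' j j' :
  rho i = rho i' -> gam j = gam j' -> ((i, j) \in T q) = ((i', j') \in T q).
Proof.
move=> er eg; apply/subtableP/subtableP => -[n nq [ri cj]]; exists n => //.
  by rewrite -(band_class r0 r_lt n er) -(band_class c0 c_lt n eg).
by rewrite (band_class r0 r_lt n er) (band_class c0 c_lt n eg).
Qed.

(** The row and the column of a cell of a subtable lie in bands of the same index, so both sides
    compare [n] with [m]. *)
Lemma subtable_match q q' i i' j j' : (i, j) \in T q -> (i', j') \in T q' ->
  (rho i == rho i') = (gam j == gam j').
Proof.
move=> /subtableP[n _ [ri cj]] /subtableP[m _ [ri' cj']].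
by rewrite (band_pblock_eq r0 r_lt ri ri') (band_pblock_eq c0 c_lt cj cj').
Qed.

(** The row band alone determines [n], and disjoint index sets share no [n]. *)
Lemma subtable_disj q q' e : e \in T q -> e \in T q' -> q = q'.
Proof.
case: e => i j /subtableP[n nq [ri _]] /subtableP[m mq' [ri' _]].
rewrite -(band_inj r_lt ri ri') {m ri'} in mq'.
have [/Nhat_disj|/Nhat_disj|/val_inj //] := ltngtP q q'.
  by move/disjointFr/(_ nq); rewrite mq'.
by move/disjointFr/(_ mq'); rewrite nq.
Qed.

End Subtables.
End BlocksOfCells.

(** * Finiteness, and assembly of the theorem *)

(** Each typed table exchanges at most four tokens for at most four, so all of them lie in the image
    of a finite type. *)
Lemma typed_tables_finite {R C : nat} N r c (S : {set cell R C}) :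
  finite_set (typed_tables N r c S).
Proof.
pose f (p : 4.-bseq (cell R C) * 4.-bseq (cell R C)) := exchange p.1 p.2.
apply: (@sub_finite_set _ _ (f @` [set: _])%classic); last first.
  by apply: finite_image; apply: finite_finset.
have mem_f ad rm z : (size ad <= 4)%N -> (size rm <= 4)%N ->
    z = exchange ad rm -> (f @` [set: _])%classic z.
  by move=> sa sb ->; exists (Bseq sa, Bseq sb).
have exE (ad rm : seq (cell R C)) : exchange ad rm =
  \sum_(e <- ad) delta_mx e.1 e.2 - \sum_(e <- rm) delta_mx e.1 e.2 by [].
move=> z; rewrite /typed_tables /=.
case=> [[i1 [i2 [j1 [j2 [_ _ ->]]]]]
       |[i1 [i2 [i3 [j1 [j2 [j3 [_ _ _ ->]]]]]]]
       |[i1 [i2 [i3 [j1 [j2 [j3 [_ _ _ _ ->]]]]]]]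
       |[[i1 [i2 [i3 [i4 [j1 [j2 [j3 [j4 [_ _ _ _ ->]]]]]]]]]
        |[i1 [i2 [i3 [i4 [j1 [j2 [j3 [j4 [_ _ _ _ ->]]]]]]]]]]].
- apply: (mem_f [:: (i1, j1); (i2, j2)] [:: (i1, j2); (i2, j1)]) => //.
  by rewrite exE !big_cons !big_nil !addr0 !opprD !addrA.
- apply: (mem_f [:: (i1, j2); (i2, j3); (i3, j1)]
                [:: (i1, j3); (i2, j1); (i3, j2)]) => //.
  by rewrite exE !big_cons !big_nil !addr0 !opprD !addrA.
- apply: (mem_f [:: (i1, j1); (i2, j3); (i3, j2)]
                [:: (i1, j3); (i2, j2); (i3, j1)]) => //.
  by rewrite exE !big_cons !big_nil !addr0 !opprD !addrA.
- apply: (mem_f [:: (i1, j1); (i2, j2); (i3, j3); (i4, j4)]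
                [:: (i1, j3); (i2, j4); (i3, j2); (i4, j1)]) => //.
  by rewrite exE !big_cons !big_nil !addr0 !opprD !addrA.
- apply: (mem_f [:: (i1, j1); (i2, j2); (i3, j3); (i4, j4)]
                [:: (i3, j1); (i4, j2); (i2, j3); (i1, j4)]) => //.
  by rewrite exE !big_cons !big_nil !addr0 !opprD !addrA.
Qed.

Theorem corollary1 (R C N Q : nat) (r c : nat -> nat)
    (Nhat : 'I_Q -> {set 'I_N}) :
  (1 <= R)%N -> (1 <= C)%N -> (1 <= N)%N -> (1 <= Q)%N ->
  r 0%N = 0%N -> (forall k, (k < N)%N -> (r k < r k.+1)%N) -> (r N <= R)%N ->
  c 0%N = 0%N -> (forall k, (k < N)%N -> (c k < c k.+1)%N) -> (c N <= C)%N ->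
  (forall q q' : 'I_Q, (q < q')%N -> [disjoint Nhat q & Nhat q']) ->
  let T : 'I_Q -> {set cell R C} := subtable r c Nhat in
  let S : {set cell R C} := (\bigcup_(q < Q) T q)%SET in
  is_markov_basis (configuration T)
    (moves (configuration T) `&` typed_tables N r c S)%classic.
Proof.
move=> _ _ _ _ r0 r_lt _ c0 c_lt _ Nhat_disj T S.
have T_class := @subtable_class R C N r c r0 c0 r_lt c_lt Q Nhat.
have T_match := @subtable_match R C N r c r0 c0 r_lt c_lt Q Nhat.
have T_disj := @subtable_disj R C N r c r_lt Q Nhat Nhat_disj.
have blk_inj := @pblock_blocks_inj R C N r c r0 c0 r_lt c_lt.
split.
- exact/finite_setIr/typed_tables_finite.
- by move=> z [].
- exact: typed_moves_opp.
- exact: typed_moves_connect T_class T_match T_disj blk_inj.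
Qed.
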